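(* Let $k$ be a positive integer. The set $$\mathcal{C}=\{A+\lambda B\in\mathcal{P}_{2k,2k}(\mathbb{R}) : \mathcal{O}(A,B)\text{ contains a pencil }Q+\lambda E\text{ where }Q\text{ has no real eigenvalues}\}$$ is open in $\mathcal{P}_{2k,2k}(\mathbb{R})$ in the norm topology.
   Context: $\mathcal{P}_{2k,2k}(\mathbb{R})$ is the real vector space of pencils $A+\lambda B$ with $A,B\in\mathbb{R}^{2k\times 2k}$, with the topology of the norm $\|A+\lambda B\|=\sqrt{\|A\|^2+\|B\|^2}$ (Frobenius norms). $E$ is the identity matrix. The group $\mathrm{GL}_{2k}(\mathbb{R})\times\mathrm{GL}_{2k}(\mathbb{R})\times\mathrm{GL}_2(\mathbb{R})$ acts by $$(P,U,T)\cdot(A+\lambda B)=P(t_{11}A+t_{12}B)U^{\sf T}+\lambda P(t_{21}A+t_{22}B)U^{\sf T},\quad T=(t_{ij}),$$ and $\mathcal{O}(A,B)$ is the orbit of $A+\lambda B$ under this action. *)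

(* Defs.v *)
From HB Require Import structures.
From mathcomp Require Import all_boot all_order all_algebra.
From mathcomp Require Import all_classical all_reals all_analysis.
From mathcomp Require Import ring lra.
Set Implicit Arguments.
Unset Strict Implicit.
Unset Printing Implicit Defensive.
Import Order.TTheory GRing.Theory Num.Theory.
Import numFieldNormedType.Exports.
Local Open Scope classical_set_scope.
Local Open Scope ring_scope.

Section L2.
Variables (R : realType) (I : finType).
Implicit Types f g : I -> R.

Definition l2 f : R := Num.sqrt (\sum_i f i ^+ 2).

Lemma sumsq_ge0 f : 0 <= \sum_i f i ^+ 2.
Proof. by apply: sumr_ge0 => i _; exact: sqr_ge0. Qed.

Lemma sqr_l2 f : l2 f ^+ 2 = \sum_i f i ^+ 2.
Proof. by rewrite /l2 sqr_sqrtr ?sumsq_ge0. Qed.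

Lemma l2_ge0 f : 0 <= l2 f. Proof. exact: sqrtr_ge0. Qed.

Lemma l2_eq0 f : l2 f = 0 -> forall i, f i = 0.
Proof.
move=> f0 i; have /eqP := sqr_l2 f; rewrite f0 expr0n eq_sym psumr_eq0.
  by move=> /allP/(_ i (mem_index_enum _))/=; rewrite sqrf_eq0 => /eqP.
by move=> j _; exact: sqr_ge0.
Qed.

Lemma cauchy_schwarz f g : \sum_i f i * g i <= l2 f * l2 g.
Proof.
set a := l2 f; set b := l2 g.
have [a0|a0] := eqVneq a 0.
  by rewrite big1 ?a0 ?mul0r// => i _; rewrite (l2_eq0 a0) mul0r.
have [b0|b0] := eqVneq b 0.
  by rewrite big1 ?b0 ?mulr0// => i _; rewrite (l2_eq0 b0) mulr0.
have ap : 0 < a by rewrite lt_def a0 l2_ge0.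
have bp : 0 < b by rewrite lt_def b0 l2_ge0.
have : 0 <= \sum_i (b * f i - a * g i) ^+ 2.
  by apply: sumr_ge0 => i _; exact: sqr_ge0.
have -> : \sum_i (b * f i - a * g i) ^+ 2 =
    b ^+ 2 * \sum_i f i ^+ 2 + a ^+ 2 * \sum_i g i ^+ 2
    - (a * b) *+ 2 * \sum_i f i * g i.
  rewrite !mulr_sumr -big_split -sumrB /=; apply: eq_bigr => i _; ring.
rewrite -!sqr_l2 -/a -/b.
have abp : 0 < a * b by rewrite mulr_gt0.
have -> : b ^+ 2 * a ^+ 2 + a ^+ 2 * b ^+ 2 - (a * b) *+ 2 * \sum_i f i * g i
    = (a * b) *+ 2 * (a * b - \sum_i f i * g i) by ring.
by rewrite pmulr_rge0 ?pmulrn_lgt0// subr_ge0.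
Qed.

Lemma l2D f g : l2 (fun i => f i + g i) <= l2 f + l2 g.
Proof.
rewrite -ler_sqr ?nnegrE ?addr_ge0 ?l2_ge0// sqrrD !sqr_l2.
have -> : \sum_i (f i + g i) ^+ 2 =
    \sum_i f i ^+ 2 + (\sum_i f i * g i) *+ 2 + \sum_i g i ^+ 2.
  by rewrite -sumrMnl -!big_split; apply: eq_bigr => i _ /=; ring.
by rewrite lerD2r lerD2l ler_wMn2r// cauchy_schwarz.
Qed.

End L2.

Section Frobenius.
Variables (R : realType) (m n : nat).
Implicit Types A B : 'M[R]_(m, n).

Definition frobenius A : R := Num.sqrt (\sum_i \sum_j A i j ^+ 2).

Lemma frobeniusE A : frobenius A = l2 (fun p : 'I_m * 'I_n => A p.1 p.2).
Proof. by rewrite /frobenius /l2 pair_big. Qed.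

Lemma frobenius_ge0 A : 0 <= frobenius A. Proof. exact: sqrtr_ge0. Qed.

Lemma frobeniusD A B : frobenius (A + B) <= frobenius A + frobenius B.
Proof.
rewrite !frobeniusE (le_trans _ (l2D _ _))// /l2.
by under eq_bigr do rewrite mxE.
Qed.

Lemma frobeniusZ (a : R) A : frobenius (a *: A) = `|a| * frobenius A.
Proof.
rewrite /frobenius -sqrtr_sqr -sqrtrM ?sqr_ge0// mulr_sumr; congr Num.sqrt.
apply: eq_bigr => i _; rewrite mulr_sumr; apply: eq_bigr => j _.
by rewrite mxE exprMn.
Qed.

Lemma frobenius_eq0 A : frobenius A = 0 -> A = 0.
Proof.
rewrite frobeniusE => /l2_eq0 A0; apply/matrixP => i j.
by rewrite mxE (A0 (i, j)).
Qed.

End Frobenius.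

(* The pair (A, B) stands for A + lambda B. An alias of the product type is
   used because the product itself carries the sup norm as canonical norm. *)
Definition pencil (R : realType) (m n : nat) : Type :=
  ('M[R]_(m, n) * 'M[R]_(m, n))%type.

HB.instance Definition _ (R : realType) (m n : nat) :=
  GRing.Lmodule.copy (pencil R m n) ('M[R]_(m, n) * 'M[R]_(m, n))%type.

Section PencilNorm.
Variables (R : realType) (m n : nat).
Implicit Types X Y : pencil R m n.

Definition pencil_norm X : R :=
  Num.sqrt (frobenius X.1 ^+ 2 + frobenius X.2 ^+ 2).

Lemma pencil_normE X :
  pencil_norm X = l2 (fun b : bool => if b then frobenius X.1 else frobenius X.2).
Proof. by rewrite /l2 big_bool. Qed.

Lemma pencil_normD X Y : pencil_norm (X + Y) <= pencil_norm X + pencil_norm Y.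
Proof.
rewrite !pencil_normE (le_trans _ (l2D _ _))// /l2 !big_bool /= ler_wsqrtr//.
by rewrite lerD// ler_sqr ?nnegrE ?addr_ge0 ?frobenius_ge0// frobeniusD.
Qed.

Lemma pencil_normZ (a : R) X : pencil_norm (a *: X) = `|a| * pencil_norm X.
Proof.
rewrite /pencil_norm !frobeniusZ -[in RHS]sqrtr_sqr -sqrtrM ?sqr_ge0//.
by rewrite mulrDr !exprMn real_normK ?num_real.
Qed.

Lemma pencil_norm_eq0 X : pencil_norm X = 0 -> X = 0.
Proof.
rewrite pencil_normE => /l2_eq0 X0.
have /frobenius_eq0 X1 := X0 true; have /frobenius_eq0 X2 := X0 false.
by case: X X1 X2 {X0} => A B /= -> ->.
Qed.

End PencilNorm.

HB.instance Definition _ (R : realType) (m n : nat) :=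
  Lmodule_isNormed.Build R (pencil R m n)
    (@pencil_normD R m n) (@pencil_normZ R m n) (@pencil_norm_eq0 R m n).

Section Orbit.
Variables (R : realType) (n : nat).
Implicit Types X : pencil R n n.

Definition pencil_act (P U : 'M[R]_n) (T : 'M[R]_2) X : pencil R n n :=
  (P *m (T 0 0 *: X.1 + T 0 1 *: X.2) *m U^T,
   P *m (T 1 0 *: X.1 + T 1 1 *: X.2) *m U^T).

Definition pencil_orbit X : set (pencil R n n) :=
  [set Y | exists P U T, [/\ P \in unitmx, U \in unitmx, T \in unitmx
                           & Y = pencil_act P U T X]].

End Orbit.

Definition orbit_no_real_eigenvalue (R : realType) (k : nat) :
    set (pencil R (2 * k) (2 * k)) :=
  [set X | exists Q : 'M[R]_(2 * k),
     pencil_orbit X (Q, 1%:M) /\ forall a : R, ~~ eigenvalue Q a].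

(* Main.v *)
(** A pencil [A + lambda B] lies in the set iff [x A + y B] is invertible for
    every real [(x, y) <> (0, 0)]: this property is invariant under the action,
    and when it holds [B] is invertible and [(B^-1 A, E)] is in the orbit.
    By homogeneity it suffices to let [(x, y)] run over the sides [(s, 1)] and
    [(1, s)], [-1 <= s <= 1], of a square; these are compact and
    [det (x A + y B)] is jointly continuous, so the condition is open. *)
Require Import Defs.
From mathcomp Require Import all_boot all_order all_algebra.
From mathcomp Require Import all_classical all_reals all_analysis.
Set Implicit Arguments.
Unset Strict Implicit.
Unset Printing Implicit Defensive.
Import Order.TTheory GRing.Theory Num.Theory.
Import numFieldNormedType.Exports.
Local Open Scope classical_set_scope.
Local Open Scope ring_scope.

Lemma eigenvalue_unitmx (F : fieldType) (n : nat) (Q : 'M[F]_n) (a : F) :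
  eigenvalue Q a = (Q - a%:M \notin unitmx).
Proof. by rewrite /eigenvalue /eigenspace kermx_eq0 row_free_unit. Qed.

Lemma unitmxZ_neq0 (F : fieldType) (n : nat) (A : 'M[F]_n) (a : F) :
  a != 0 -> (a *: A \in unitmx) = (A \in unitmx).
Proof. by move=> a0; rewrite unitmxZ// unitfE. Qed.

Section PencilContinuity.
Variables (R : realType) (m n : nat).

Lemma ler_frobenius (A : 'M[R]_(m, n)) i j : `|A i j| <= frobenius A.
Proof.
rewrite -ler_sqr ?nnegrE ?frobenius_ge0// frobeniusE sqr_l2.
rewrite (bigD1 (i, j))//= real_normK ?num_real// lerDl.
by apply: sumr_ge0 => p _; exact: sqr_ge0.
Qed.

Lemma frobenius_le_pencil_norm (X : pencil R m n) :
  frobenius X.1 <= pencil_norm X /\ frobenius X.2 <= pencil_norm X.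
Proof.
by split; rewrite -[leLHS]ger0_norm ?frobenius_ge0// -sqrtr_sqr;
  rewrite ler_wsqrtr// ?lerDl ?lerDr sqr_ge0.
Qed.

(** Coordinates are 1-Lipschitz: an entry is bounded by the Frobenius norm of its matrix, which is
    bounded by the pencil norm. *)
Lemma continuous_pencil_fst i j :
  continuous (fun X : pencil R m n => X.1 i j).
Proof.
move=> X; have FX : Filter (nbhs X) by exact: nbhs_filter.
apply/cvgrPdist_lt => e e0.
near=> Y; have : `|X - Y| < e by near: Y; exact: cvgr_dist_lt.
apply: le_lt_trans.
apply: le_trans (frobenius_le_pencil_norm (X - Y)).1.
by have := ler_frobenius (X - Y).1 i j; rewrite !mxE.
Unshelve. all: by end_near. Qed.

Lemma continuous_pencil_snd i j :
  continuous (fun X : pencil R m n => X.2 i j).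
Proof.
move=> X; have FX : Filter (nbhs X) by exact: nbhs_filter.
apply/cvgrPdist_lt => e e0.
near=> Y; have : `|X - Y| < e by near: Y; exact: cvgr_dist_lt.
apply: le_lt_trans.
apply: le_trans (frobenius_le_pencil_norm (X - Y)).2.
by have := ler_frobenius (X - Y).2 i j; rewrite !mxE.
Unshelve. all: by end_near. Qed.

End PencilContinuity.

(** By the Leibniz formula, [\det] is a finite sum of signed finite products of entries. *)
Lemma cvg_det (R : realType) (T : Type) (F : set_system T) (n : nat)
    (M : T -> 'M[R]_n) (N : 'M[R]_n) : Filter F ->
  (forall i j, M t i j @[t --> F] --> N i j) ->
  \det (M t) @[t --> F] --> \det N.
Proof.
move=> FF MN; rewrite /determinant.
apply: (cvg_big (op := +%R)) => [|s _]; first exact: add_continuous.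
apply: cvgMl_tmp.
apply: (cvg_big (U := R) (op := *%R)) => [|i _]; first exact: mul_continuous.
exact: MN.
Qed.

(** A tube-lemma argument: for each [s] the determinant stays nonzero on a product neighbourhood of
    [(s, X)], and compactness of [[-1, 1]] yields one neighbourhood of [X] that serves all [s]. *)
Lemma open_unitmx_segment (R : realType) (V : topologicalType) (n : nat)
    (a b : R -> R) (A B : V -> 'M[R]_n) :
  continuous a -> continuous b ->
  (forall i j, continuous (fun X => A X i j)) ->
  (forall i j, continuous (fun X => B X i j)) ->
  open [set X | forall s, s \in `[-1, 1] -> a s *: A X + b s *: B X \in unitmx].
Proof.
move=> ca cb cA cB; rewrite openE => X /= hX.
have /compact_near_coveringP nc := @segment_compact R (-1) 1.
apply: (nc _ (nbhs X) (fun Y s => a s *: A Y + b s *: B Y \in unitmx)) => s hs.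
have dX : \det (a s *: A X + b s *: B X) != 0 by rewrite -unitfE; exact: hX.
have : \forall p \near filter_prod (nbhs s) (nbhs X),
    \det (a p.1 *: A p.2 + b p.1 *: B p.2) != 0.
  apply: (cvgr_neq0 _ _ dX); apply: cvg_det => i j.
  rewrite !mxE; under eq_fun do rewrite !mxE.
  apply: cvgD; apply: cvgM.
  - by apply: (@cvg_comp _ _ _ fst _ _ (nbhs s)); [exact: cvg_fst|exact: ca].
  - by apply: (@cvg_comp _ _ _ snd (fun Y => A Y i j) _ (nbhs X));
    [exact: cvg_snd|exact: cA].
  - by apply: (@cvg_comp _ _ _ fst _ _ (nbhs s)); [exact: cvg_fst|exact: cb].
  - by apply: (@cvg_comp _ _ _ snd (fun Y => B Y i j) _ (nbhs X));
    [exact: cvg_snd|exact: cB].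
by apply: filterS => -[t Y] /=; rewrite unitmxE unitfE.
Qed.

(** The action turns combinations of [X.1] and [X.2] into combinations of [Q] and [E], nonzero
    coefficients staying nonzero; for the latter, invertibility is the absence of real eigenvalues
    of [Q]. *)
Lemma orbit_no_real_eigenvalue_unitmx (R : realType) (k : nat)
    (X : pencil R (2 * k) (2 * k)) (x y : R) :
  orbit_no_real_eigenvalue X -> (x != 0) || (y != 0) ->
  x *: X.1 + y *: X.2 \in unitmx.
Proof.
move=> [Q [[P [U [T [uP uU uT [eQ eE]]]]] hQ]] xy.
pose v : 'rV[R]_2 := \row_j (if j == 0 then x else y).
(* [w] holds the coordinates of the combination with respect to [Q] and [E]. *)
have [w wT] : exists w, w *m T = v by exists (v *m invmx T); rewrite mulmxKV.
have l1 : lift ord0 ord0 = 1 :> 'I_2 by exact: val_inj.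
have xE : x = w 0 0 * T 0 0 + w 0 1 * T 1 0.
  have /matrixP/(_ 0 0) := wT.
  by rewrite !mxE eqxx !big_ord_recl big_ord0 addr0 l1 => <-.
have yE : y = w 0 0 * T 0 1 + w 0 1 * T 1 1.
  have /matrixP/(_ 0 1) := wT.
  by rewrite !mxE !big_ord_recl big_ord0 addr0 l1 /= => <-.
have : P *m (x *: X.1 + y *: X.2) *m U^T \in unitmx.
  have -> : P *m (x *: X.1 + y *: X.2) *m U^T = w 0 0 *: Q + w 0 1 *: 1%:M.
    rewrite eQ eE !(scalemxAl _ (P *m _)) !scalemxAr -mulmxDl -mulmxDr.
    congr (_ *m _ *m _).
    rewrite !scalerDr !scalerA addrACA -!scalerDl.
    by rewrite -xE -yE.
  (* If the coefficient of [Q] vanishes, that of [E] cannot, since [w = 0] would force [x = y = 0].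
     Otherwise it is factored out, leaving [Q] minus a real scalar. *)
  have [w0|w0] := eqVneq (w 0 0) 0.
    rewrite w0 scale0r add0r unitmxZ_neq0 ?unitmx1//.
    apply: contraTneq xy => w1.
    by rewrite xE yE w0 w1 !mul0r addr0 eqxx.
  have -> : w 0 0 *: Q + w 0 1 *: 1%:M
      = w 0 0 *: (Q - (- (w 0 1 / w 0 0))%:M).
    rewrite scalerBr -[(- _)%:M]scalemx1 scalerA mulrN scaleNr opprK.
    by rewrite mulrCA divff// mulr1.
  by rewrite unitmxZ_neq0//; have := hQ (- (w 0 1 / w 0 0));
     rewrite eigenvalue_unitmx negbK.
by rewrite !unitmx_mul => /andP[/andP[]].
Qed.

(** For the converse inclusion, [B^-1 A - a E = B^-1 (A - a B)] reduces everything to the points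
    [(1, -a)]. *)
Lemma orbit_no_real_eigenvalue_segments (R : realType) (k : nat) :
  @orbit_no_real_eigenvalue R k =
  [set X | forall s, s \in `[-1, 1] -> s *: X.1 + 1 *: X.2 \in unitmx] `&`
  [set X | forall s, s \in `[-1, 1] -> 1 *: X.1 + s *: X.2 \in unitmx].
Proof.
apply/seteqP; split=> [X hX|X [h1 h2]].
  split=> s _; apply: (orbit_no_real_eigenvalue_unitmx hX);
  by rewrite oner_neq0 ?orbT.
have uB : X.2 \in unitmx.
  (* The midpoint [(0, 1)] of the first segment gives [B] itself. *)
  have := h1 0; rewrite scale0r add0r scale1r; apply.
  by rewrite in_itv/= ler01 lerN10.
exists (invmx X.2 *m X.1); split.
  exists (invmx X.2), 1%:M, 1%:M; rewrite unitmx_inv; split => //.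
  - exact: unitmx1.
  - exact: unitmx1.
  - rewrite /pencil_act trmx1 !mulmx1 !mxE /= !scale1r !scale0r addr0 add0r.
    by rewrite mulVmx.
move=> a; rewrite eigenvalue_unitmx negbK.
have -> : invmx X.2 *m X.1 - a%:M = invmx X.2 *m (X.1 - a *: X.2).
  by rewrite mulmxBr -scalemxAr mulVmx// scalemx1.
rewrite unitmx_mul unitmx_inv uB /=.
(* For [|a| <= 1] the point [(1, -a)] lies on the second segment; otherwise it is [-a] times
   [(-1/a, 1)], a point of the first. *)
have [a1|a1] := lerP `|a| 1.
  have := h2 (- a); rewrite scale1r scaleNr; apply.
  by rewrite in_itv/= -ler_norml normrN.
have a0 : a != 0 by rewrite -normr_gt0 (lt_trans ltr01).
have -> : X.1 - a *: X.2 = (- a) *: ((- a^-1) *: X.1 + 1 *: X.2).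
  by rewrite scalerDr !scalerA mulrNN divff// mulr1 scale1r scaleNr.
rewrite unitmxZ_neq0 ?oppr_eq0//; apply: h1.
by rewrite in_itv/= -ler_norml normrN normfV invf_le1 ?ltW// (lt_trans ltr01).
Qed.

Theorem lemma19 (R : realType) (k : nat) (k_gt0 : (0 < k)%N) :
  open (@orbit_no_real_eigenvalue R k).
Proof.
rewrite orbit_no_real_eigenvalue_segments; apply: openI.
  apply: (open_unitmx_segment (a := id) (b := fun=> 1)) => [s|s|i j|i j].
  - exact: cvg_id.
  - exact: cvg_cst.
  - exact: continuous_pencil_fst.
  - exact: continuous_pencil_snd.
apply: (open_unitmx_segment (a := fun=> 1) (b := id)) => [s|s|i j|i j].
- exact: cvg_cst.
- exact: cvg_id.
- exact: continuous_pencil_fst.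
- exact: continuous_pencil_snd.
Qed.
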